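(* Let $\Bbbk$ be a perfect field, let $m$ be a positive integer, and let $g,g_0,g_1,\ldots,g_{m-1}\in\Bbbk[x]$ be polynomials. Assume that $g$ is separable of degree $n$ and that $\gcd(g_i,g)=1$ for $0\le i\le m-1$. Then for any $f_0,f_1,\ldots,f_{m-1}\in\Bbbk[x]$ there exists a unique $r\in\Bbbk[x]$ of degree less than $mn$ such that $$g_i\,r^{(i)}\equiv f_i\pmod g,\qquad 0\le i\le m-1.$$
   Context: A polynomial is separable if it has no multiple roots in the algebraic closure of $\Bbbk$. $r^{(i)}$ denotes the $i$-th (formal) derivative of $r$.
   Formalization: The field is additionally assumed to have characteristic 0 or at least m; in characteristic p with 0 < p < m, r^(p) = 0 for every r, so the claim as printed fails whenever n ≥ 1 (the trivial case n = 0 in such characteristic is not covered). *)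

(* Defs.v *)
From HB Require Import structures.
From mathcomp Require Import all_boot all_order all_algebra all_field.

Set Implicit Arguments.
Unset Strict Implicit.
Unset Printing Implicit Defensive.

Import GRing.Theory.
Local Open Scope ring_scope.

Definition perfect_field (k : fieldType) : Prop :=
  forall p : {poly k}, irreducible_poly p -> separable_poly p.

(* [separable_poly g] is coprimality of g and g'.  The next lemma identifies it
   with the absence of multiple roots in any algebraically closed extension L,
   in particular in an algebraic closure of k. *)
Lemma separable_poly_multiple_roots (k : fieldType) (L : closedFieldType)
    (iota : {rmorphism k -> L}) (g : {poly k}) :
  separable_poly g <->
  (forall x : L, ~~ (('X - x%:P) ^+ 2 %| map_poly iota g)).
Proof.
rewrite -(separable_map iota); set h := map_poly iota g; split=> [sep_h x|noM].
  apply/negP => xx; have [sq _] := separable_polyP sep_h.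
  have /eqP := sq ('X - x%:P) ('X - x%:P) xx.
  by rewrite /coprimep gcdpp => /eqP; rewrite size_XsubC.
rewrite unlock; apply: contraT => nc.
have /closed_rootP[x] : size (gcdp h h^`()) != 1 by exact: nc.
rewrite root_gcd => /andP[/factor_theorem[q Dh]].
rewrite Dh derivM derivXsubC mulr1 rootE !hornerE subrr mulr0 add0r => /eqP qx0.
have /factor_theorem[s Dq]: root q x by rewrite rootE qx0.
by have := noM x; rewrite Dh Dq -mulrA -expr2 dvdp_mulIr.
Qed.

(* Iterated formal derivatives of order at least p vanish in characteristic p.
   Hence if 0 < p < m and g is not constant, the congruence of index i = p in
   the interpolation problem has no solution r as soon as g does not divide
   f_p: solvability forces the characteristic to be 0 or at least m. *)
Lemma derivn_pchar (k : fieldType) (p : nat) (r : {poly k}) :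
  p \in [pchar k] -> r^`(p) = 0.
Proof.
move=> chp; rewrite nderivn_def; apply/polyP => i.
have p_gt0 := prime_gt0 (pcharf_prime chp).
rewrite coefMn coef0 -mulr_natr.
have /eqP -> : (p`!)%:R == 0 :> k.
  by rewrite -(dvdn_pcharf chp) dvdn_fact // p_gt0 leqnn.
by rewrite mulr0.
Qed.

Lemma unsolvable_small_pchar (k : fieldType) (m p : nat) (g : {poly k})
    (g_ : 'I_m -> {poly k}) :
  p \in [pchar k] -> (p < m)%N -> (1 < size g)%N ->
  exists f_ : 'I_m -> {poly k},
    forall r, ~ (forall i : 'I_m, g %| g_ i * r^`(i) - f_ i).
Proof.
move=> chp lt_pm g_gt1; exists (fun=> 1) => r /(_ (Ordinal lt_pm)) /=.
rewrite (derivn_pchar r chp) mulr0 sub0r dvdpNr dvdp1.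
by case: (size g) g_gt1 => [|[|]].
Qed.

(* Main.v *)
Require Import Defs.
From HB Require Import structures.
From mathcomp Require Import all_boot all_order all_algebra all_field ring.

Set Implicit Arguments.
Unset Strict Implicit.
Unset Printing Implicit Defensive.

Import GRing.Theory.
Local Open Scope ring_scope.

(** The conditions are solved one derivative at a time, in the [g]-adic
    expansion of [r]. The [j]-th derivative of [s * g ^+ j] is congruent to
    [j! * s * g' ^+ j] modulo [g], while its lower derivatives vanish modulo
    [g]. As [j!] is invertible for [j < m], the
    characteristic being [0] or at least [m], and [g'] is coprime to [g], the
    [j]-th condition determines the [j]-th digit [s] modulo [g]. *)

Lemma derivn_mul_expr (R : comNzRingType) (i j : nat) (s g : {poly R}) :
  exists u, (s * g ^+ (i + j))^`(i) =
    (s * g^`() ^+ i *+ (i + j) ^_ i + u * g) * g ^+ j.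
Proof.
elim: i s => [|i IHi] s.
  by exists 0; rewrite derivn0 expr0 mulr1 ffactn0 mulr1n mul0r addr0.
pose t := s^`() * g + s * g^`() *+ (i + j).+1.
have dE : (s * g ^+ (i.+1 + j))^`() = t * g ^+ (i + j).
  rewrite derivM deriv_exp /t addSn /= exprS -mulrnAl.
  by rewrite mulrDl mulrnAl mulrnAr mulrA mulrA -mulrnAl.
have [u uE] := IHi t; exists (s^`() * g^`() ^+ i *+ (i + j) ^_ i + u).
rewrite derivSn dE uE; congr (_ * _).
rewrite /t addSn ffactSS exprS.
move: ((i + j) ^_ i)%N (i + j).+1 (g^`() ^+ i) => a b c; ring.
Qed.

(** Every prime factor of [j!] is at most [j], hence below [m], so it cannot be the
    characteristic. *)
Lemma natf_fact_neq0 (F : fieldType) (m j : nat) :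
    (forall p : nat, p \in [pchar F] -> (m <= p)%N) -> (j < m)%N ->
  j`!%:R != 0 :> F.
Proof.
move=> charF; elim: j => [|j IHj] lt_jm; first by rewrite oner_neq0.
rewrite factS natrM mulf_neq0 ?IHj ?(ltnW lt_jm) // natf_neq0_pchar.
apply/pnatP=> // p _ p_dvd; rewrite inE; apply/negP => /charF.
by rewrite leqNgt (leq_ltn_trans (dvdn_leq _ p_dvd) lt_jm).
Qed.

(** A Bezout coefficient [u] inverts [a] modulo [g]; reducing [u * b] modulo [g] gives a digit of
    the [g]-adic expansion. *)
Lemma coprimep_solve_mod (F : fieldType) (a b g : {poly F}) :
    coprimep a g -> g != 0 ->
  exists2 s : {poly F}, (size s < size g)%N & g %| a * s - b.
Proof.
move=> /Bezout_eq1_coprimepP[[u v] /= uv1] g0; exists ((u * b) %% g).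
  by rewrite ltn_modp.
have {1}-> : (u * b) %% g = u * b - (u * b) %/ g * g.
  by rewrite {2}(divp_eq (u * b) g) addrC addKr.
have -> : a * (u * b - u * b %/ g * g) - b
    = - (v * b + a * (u * b %/ g)) * g.
  by rewrite -[b in _ - b]mul1r -uv1; ring.
exact: dvdp_mull.
Qed.

Lemma dvdp_derivn_mul_expr (F : fieldType) (i j : nat) (s g : {poly F}) :
  (i < j)%N -> g %| (s * g ^+ j)^`(i).
Proof.
move=> /subnKC <-; rewrite addSnnS.
have [u ->] := derivn_mul_expr i (j - i.+1).+1 s g.
by rewrite exprS mulrCA dvdp_mulIl.
Qed.

Lemma derivn_mul_expr_diag (F : fieldType) (j : nat) (s g : {poly F}) :
  exists u, (s * g ^+ j)^`(j) = j`!%:R *: (s * g^`() ^+ j) + u * g.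
Proof.
have [u] := derivn_mul_expr j 0 s g; rewrite addn0 ffactnn expr0 mulr1 => ->.
by exists u; rewrite scaler_nat.
Qed.

Lemma dvdp_expr_derivn (F : fieldType) (m : nat) (g d : {poly F}) :
    (forall p : nat, p \in [pchar F] -> (m <= p)%N) -> separable_poly g ->
    (forall i, (i < m)%N -> g %| d^`(i)) ->
  g ^+ m %| d.
Proof.
move=> charF sep_g g_dvd; suff: forall j, (j <= m)%N -> g ^+ j %| d by apply.
elim=> [|j IHj] lt_jm; first by rewrite expr0 dvd1p.
have /dvdpP[s dE] := IHj (ltnW lt_jm).
have := g_dvd j lt_jm; have [u] := derivn_mul_expr_diag j s g.
rewrite -dE => ->; rewrite dvdp_addl ?dvdp_mulIr //.
rewrite dvdpZr ?(natf_fact_neq0 charF) //.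
rewrite unlock in sep_g; rewrite Gauss_dvdpl ?coprimep_expr // => g_dvd_s.
by rewrite dE exprS dvdp_mul.
Qed.

Lemma derivn_interpolation_exists (F : fieldType) (m n j : nat)
    (g : {poly F}) (g_ f_ : nat -> {poly F}) :
    (forall p : nat, p \in [pchar F] -> (m <= p)%N) ->
    separable_poly g -> size g = n.+1 ->
    (forall i, (i < m)%N -> coprimep (g_ i) g) -> (j <= m)%N ->
  exists2 r : {poly F}, (size r <= j * n)%N &
    forall i, (i < j)%N -> g %| g_ i * r^`(i) - f_ i.
Proof.
move=> charF sep_g size_g cop_g; elim: j => [|j IHj] lt_jm.
  by exists 0; rewrite ?size_poly0.
have [r size_r rP] := IHj (ltnW lt_jm).
have g0 : g != 0 by rewrite -size_poly_eq0 size_g.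
have cop_a : coprimep (j`!%:R *: (g_ j * g^`() ^+ j)) g.
  rewrite coprimepZl ?(natf_fact_neq0 charF) // coprimepMl cop_g //.
  by rewrite coprimep_expl // coprimep_sym; rewrite unlock in sep_g.
have [s size_s sP] := coprimep_solve_mod (f_ j - g_ j * r^`(j)) cop_a g0.
(* The new term has derivatives of order below [j] divisible by [g], so the earlier conditions
   persist. Its size is at most [n + j * n], since [s] has size at most [n] and [g ^+ j] at most
   [j * n + 1]. *)
exists (r + s * g ^+ j).
  apply: leq_trans (size_polyD _ _) _; rewrite geq_max; apply/andP; split.
    by rewrite (leq_trans size_r) // leq_mul2r leqnSn orbT.
  apply: leq_trans (size_polyMleq _ _) _.
  have := size_poly_exp_leq g j; rewrite size_g /= => size_gj.
  rewrite size_g ltnS in size_s; rewrite -subn1 leq_subLR add1n mulSn -addnS.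
  by rewrite leq_add // mulnC.
move=> i; rewrite ltnS leq_eqVlt derivnD mulrDr => /predU1P[->|lt_ij].
  have [u ->] := derivn_mul_expr_diag j s g.
  have -> : g_ j * r^`(j) + g_ j * (j`!%:R *: (s * g^`() ^+ j) + u * g) - f_ j
     = (j`!%:R *: (g_ j * g^`() ^+ j) * s - (f_ j - g_ j * r^`(j)))
       + g_ j * u * g by rewrite -!mul_polyC; ring.
  by rewrite dvdp_addl ?dvdp_mulIr.
by rewrite addrAC dvdp_addl ?rP // dvdp_mull ?dvdp_derivn_mul_expr.
Qed.

Theorem mainTheorem5 (k : fieldType) (hk : perfect_field k)
    (m : nat) (hm : (0 < m)%N)
    (hchar : forall p : nat, p \in [pchar k] -> (m <= p)%N)
    (n : nat) (g : {poly k}) (g_ : 'I_m -> {poly k})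
    (gsep : separable_poly g) (gdeg : size g = n.+1)
    (gcop : forall i : 'I_m, coprimep (g_ i) g)
    (f_ : 'I_m -> {poly k}) :
  exists! r : {poly k},
    (size r <= m * n)%N /\
    forall i : 'I_m, g %| g_ i * r^`(i) - f_ i.
Proof.
(* The families are extended to all naturals for the induction on the number of conditions; the
   default values are arbitrary. *)
pose G i := oapp g_ 1 (insub i); pose H i := oapp f_ 0 (insub i).
have GE (i : 'I_m) : G i = g_ i by rewrite /G valK.
have HE (i : 'I_m) : H i = f_ i by rewrite /H valK.
have cop_G i : (i < m)%N -> coprimep (G i) g.
  by move=> lt_im; rewrite -[i]/(val (Ordinal lt_im)) GE.
have [r size_r rP] :=
  derivn_interpolation_exists H hchar gsep gdeg cop_G (leqnn m).
exists r; split=> [|r' [size_r' r'P]].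
  by split=> // i; rewrite -GE -HE rP.
apply/eqP; rewrite -subr_eq0; apply: contraT => d0.
have g0 : g != 0 by rewrite -size_poly_eq0 gdeg.
have /(dvdp_leq d0) : g ^+ m %| r - r'.
  apply: dvdp_expr_derivn => // i lt_im; pose o := Ordinal lt_im.
  (* The factor [g_ o], invertible modulo [g], is restored so that the two congruences can be
     subtracted. *)
  rewrite -(Gauss_dvdpr _ (_ : coprimep g (g_ o))) 1?coprimep_sym //.
  have -> : g_ o * (r - r')^`(i) =
      (g_ o * r^`(i) - f_ o) - (g_ o * r'^`(i) - f_ o).
    by rewrite derivnB; ring.
  by rewrite dvdp_sub // ?(r'P o) // -GE -HE rP.
(* The difference has size at most [m * n], whereas [g ^+ m] has size [m * n + 1]. *)
rewrite leqNgt => /negP[]; apply: (@leq_ltn_trans (m * n)%N).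
  by apply: leq_trans (size_polyD _ _) _; rewrite size_polyN geq_max size_r.
have := size_exp g m; rewrite gdeg /= mulnC => <-.
by rewrite ltn_predL size_poly_gt0 expf_neq0.
Qed.
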